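(* Let $\mathcal I$ uniformly parameter-interpret a class $\mathcal D$ in a class $\mathcal C$ with arity $r$, and let $\mathcal J$ uniformly parameter-interpret a class $\mathcal E$ in $\mathcal D$ with arity $q$. If both interpretations admit uniform definable selectors and are selector-trace reflecting (each with respect to its selector), then the composite interpretation of $\mathcal E$ in $\mathcal C$ has arity $rq$, admits a uniform definable selector, and is selector-trace reflecting.
   Context: $\mathcal C,\mathcal D,\mathcal E$ are classes of finite structures in countable first-order languages $L,L',L''$ respectively (function and constant symbols may be replaced by graph relations). Uniform parameter-interpretation $\mathcal I$ of $\mathcal D$ in $\mathcal C$, of arity $r\ge1$: an injection $\alpha:\mathcal D\to\mathcal C$; an integer $s\ge0$; fixed $L$-formulas $\delta(\bar u;\bar z)$, $\epsilon(\bar u,\bar v;\bar z)$ with $|\bar u|=|\bar v|=r$, $|\bar z|=s$; for each relation symbol $R\in L'$ a fixed $L$-formula $R^{\mathcal I}$ on the appropriate number of $r$-tuples (and $\bar z$); and for each $A\in\mathcal D$ a tuple $\bar c_A\in\alpha(A)^s$ and an $L'$-isomorphism $\iota_A:A\to X_A/E_A$, where $X_A=\delta(\alpha(A)^r;\bar c_A)$ and $E_A$ is the equivalence relation on $X_A$ defined by $\epsilon(\bar u,\bar v;\bar c_A)$; the formulas $R^{\mathcal I}$ (evaluated at $\bar c_A$) are $E_A$-invariant on $X_A$ and induce the $L'$-structure on $X_A/E_A$. A representative of $a\in A$ is an element of the class $\iota_A(a)$. Uniform definable selector: an $L$-formula $\sigma(\bar u;\bar z)$ such that for every $A\in\mathcal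 D$ the set $S_A=\sigma(\alpha(A)^r;\bar c_A)\subseteq X_A$ meets every $E_A$-class in exactly one element (the selected representative). Selector-trace reflecting: for every $m\ge0$ and every parameter-free $L$-formula $\rho(\bar v_1,\dots,\bar v_m;\bar z)$ (each $\bar v_i$ an $r$-tuple, $|\bar z|=s$) there is a parameter-free $L'$-formula $\rho^{\downarrow}(y_1,\dots,y_m)$ such that for every $A\in\mathcal D$ and $\bar a\in A^m$ with selected representatives $\widetilde{\bar a}\in S_A^m$: $A\models\rho^{\downarrow}(\bar a)\iff\alpha(A)\models\rho(\widetilde{\bar a};\bar c_A)$. Composite interpretation (with selectors). For $B\in\mathcal E$, let $A\in\mathcal D$ be associated with $B$ by $\mathcal J$ and $M=\alpha(A)\in\mathcal C$ associated with $A$ by $\mathcal I$. A composite representative of an element of $B$ is an $rq$-tuple from $M$ obtained from a $q$-tuple of elements of $A$ representing it under $\mathcal J$ by replacing each coordinate by its $\mathcal I$-selected representative in $M^r$. The domain, equivalence and relation formulas are the translations through $\mathcal I$ of those of $\mathcal J$, together with the $\mathcal I$-selector condition on every $r$-block. The composite interpretation parameters are the $\mathcal I$-selected representatives of the entries of the interpretation-parameter tuple of $\mathcal J$ for $B$, concatenated with the interpretation parameters $\bar c_A$ of $\mathcal I$. *)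

(* Defs.v *)
From mathcomp Require Import all_boot.

Set Implicit Arguments.
Unset Strict Implicit.
Unset Printing Implicit Defensive.

(* Countable relational languages: function and constant symbols are replaced
   by their graph relations.  Equality is a logical symbol. *)
Record language := Language {
  symbol :> countType;
  arity : symbol -> nat }.

Record fin_structure (L : language) := FinStructure {
  carrier :> finType;
  interp : forall R : L, (arity R).-tuple carrier -> bool }.

Definition isomorphism (L : language) (A B : fin_structure L) (f : A -> B) :=
  bijective f /\
  forall (R : L) (a : (arity R).-tuple A), interp (map_tuple f a) = interp a.

(* First-order formulas whose free variables are taken from V; under a
   quantifier, None is the bound variable.  The other connectives are derived,
   which is harmless since [sat] is boolean. *)
Inductive formula (L : language) (V : Type) : Type :=
| FBot
| FEq of V & V
| FRel (R : L) of (arity R).-tuple V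
| FImp of formula L V & formula L V
| FAll of formula L (option V).

Arguments FBot {L V}.
Arguments FEq {L V}.
Arguments FRel {L V}.
Arguments FImp {L V}.
Arguments FAll {L V}.

Definition FTop {L : language} {V : Type} : formula L V := FImp FBot FBot.

Definition FAnd {L : language} {V : Type} (f g : formula L V) : formula L V :=
  FImp (FImp f (FImp g FBot)) FBot.

Definition FConj {L : language} {V : Type} {T : finType}
    (F : T -> formula L V) : formula L V :=
  foldr FAnd FTop [seq F i | i <- enum T].

Fixpoint sat (L : language) (M : fin_structure L) (V : Type)
    (f : formula L V) : (V -> M) -> bool :=
  match f with
  | FBot => fun _ => false
  | FEq x y => fun e => e x == e y
  | FRel R xs => fun e => interp (map_tuple e xs)
  | FImp g h => fun e => sat g e ==> sat h e
  | FAll g => fun e => [forall a : M, sat g (oapp e a)]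
  end.

Fixpoint rename (L : language) (V W : Type) (h : V -> W)
    (f : formula L V) : formula L W :=
  match f with
  | FBot => FBot
  | FEq x y => FEq (h x) (h y)
  | FRel R xs => FRel R (map_tuple h xs)
  | FImp g1 g2 => FImp (rename h g1) (rename h g2)
  | FAll g => FAll (rename (omap h) g)
  end.

(* Universal quantification over the n variables [inr i]. *)
Fixpoint FAlls (L : language) (n : nat) (V : Type) :
    formula L (V + 'I_n) -> formula L V :=
  match n return formula L (V + 'I_n) -> formula L V with
  | 0 => rename (fun v : V + 'I_0 => match v with
                          | inl w => w
                          | inr i => match notF (ltn_ord i) with end
                          end)
  | n'.+1 => fun f => FAlls (FAll (rename (fun v =>
      match v with
      | inl w => Some (inl w)
      | inr i => omap inr (unlift ord0 i)
      end) f))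
  end.

(* Variables of a formula phi(v_1, ..., v_m; z) where each v_i is an r-tuple
   and z an s-tuple. *)
Definition block_var (m r s : nat) : Type := ('I_m * 'I_r + 'I_s)%type.

Definition holds (L : language) (M : fin_structure L) (m r s : nat)
    (f : formula L (block_var m r s))
    (x : m.-tuple (r.-tuple M)) (c : s.-tuple M) : bool :=
  sat f (fun v => match v with
                  | inl (i, j) => tnth (tnth x i) j
                  | inr k => tnth c k
                  end).

Definition class (L : language) := fin_structure L -> Prop.

Definition member (L : language) (K : class L) : Type :=
  {A : fin_structure L | K A}.

Definition member_structure (L : language) (K : class L) (A : member K) :
  fin_structure L := sval A.
Coercion member_structure : member >-> fin_structure.

(* The data of a uniform parameter-interpretation of D in C, of arity r; the
   conditions it must satisfy are in [is_interpretation].  Elements of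
   X_A / E_A are represented as subsets of alpha(A)^r; [quot_map] is the map
   A -> X_A / E_A, so x is a representative of a iff x \in quot_map a. *)
Record interp_data (L L' : language) (C : class L) (D : class L') (r : nat) :=
  InterpData {
    alpha : member D -> member C;
    nparams : nat;
    dom_fml : formula L (block_var 1 r nparams);
    eqv_fml : formula L (block_var 2 r nparams);
    rel_fml : forall R : L', formula L (block_var (arity R) r nparams);
    params : forall A : member D, nparams.-tuple (alpha A);
    quot_map : forall A : member D, A -> {set r.-tuple (alpha A)} }.

Definition dom_set (L L' : language) (C : class L) (D : class L') (r : nat)
    (I : interp_data C D r) (A : member D) : {set r.-tuple (alpha I A)} :=
  [set x | holds (dom_fml I) [tuple x] (params I A)].

Definition eqv_rel (L L' : language) (C : class L) (D : class L') (r : nat)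
    (I : interp_data C D r) (A : member D) : rel (r.-tuple (alpha I A)) :=
  fun x y => holds (eqv_fml I) [tuple x; y] (params I A).

Definition equiv_classes (L L' : language) (C : class L) (D : class L')
    (r : nat) (I : interp_data C D r) (A : member D) : {set {set r.-tuple (alpha I A)}} :=
  equivalence_partition (@eqv_rel L L' C D r I A) (dom_set I A).

Definition quotient (L L' : language) (C : class L) (D : class L') (r : nat)
    (I : interp_data C D r) (A : member D) : fin_structure L' :=
  @FinStructure L' {K : {set r.-tuple (alpha I A)} | K \in equiv_classes I A}
    (fun R Ks =>
       [exists x : (arity R).-tuple (r.-tuple (alpha I A)),
          [forall i, tnth x i \in val (tnth Ks i)] &&
          holds (rel_fml I R) x (params I A)]).

Record is_interpretation (L L' : language) (C : class L) (D : class L')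
    (r : nat) (I : interp_data C D r) : Prop := IsInterpretation {
  arity_gt0 : 0 < r;
  alpha_inj : injective (alpha I);
  eqv_equivalence : forall A : member D,
    {in dom_set I A & &, equivalence_rel (@eqv_rel L L' C D r I A)};
  rel_invariant : forall (A : member D) (R : L')
      (x y : (arity R).-tuple (r.-tuple (alpha I A))),
    (forall i, [/\ tnth x i \in dom_set I A, tnth y i \in dom_set I A
                 & eqv_rel (tnth x i) (tnth y i)]) ->
    holds (rel_fml I R) x (params I A) = holds (rel_fml I R) y (params I A);
  quot_map_iso : forall A : member D, exists f : A -> quotient I A,
    isomorphism f /\ forall a : A, val (f a) = quot_map I a }.

Definition sel_set (L L' : language) (C : class L) (D : class L') (r : nat)
    (I : interp_data C D r) (sigma : formula L (block_var 1 r (nparams I)))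
    (A : member D) : {set r.-tuple (alpha I A)} :=
  [set x | holds sigma [tuple x] (params I A)].

Definition is_selector (L L' : language) (C : class L) (D : class L') (r : nat)
    (I : interp_data C D r) (sigma : formula L (block_var 1 r (nparams I))) :
    Prop :=
  forall A : member D,
    sel_set sigma A \subset dom_set I A /\
    forall K, K \in equiv_classes I A -> #|sel_set sigma A :&: K| = 1.

Definition selected_rep (L L' : language) (C : class L) (D : class L')
    (r : nat) (I : interp_data C D r)
    (sigma : formula L (block_var 1 r (nparams I)))
    (A : member D) (a : A) (x : r.-tuple (alpha I A)) : bool :=
  (x \in quot_map I a) && (x \in sel_set sigma A).

Definition trace_reflecting (L L' : language) (C : class L) (D : class L')
    (r : nat) (I : interp_data C D r)
    (sigma : formula L (block_var 1 r (nparams I))) : Prop :=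
  forall (m : nat) (rho : formula L (block_var m r (nparams I))),
  exists rho_down : formula L' 'I_m,
  forall (A : member D) (a : m.-tuple A) (x : m.-tuple (r.-tuple (alpha I A))),
    (forall i, selected_rep sigma (tnth a i) (tnth x i)) ->
    sat rho_down (tnth a) = holds rho x (params I A).

Lemma selected_rep_exists (L L' : language) (C : class L) (D : class L')
    (r : nat) (I : interp_data C D r)
    (sigma : formula L (block_var 1 r (nparams I)))
    (hI : is_interpretation I) (hsigma : is_selector sigma)
    (A : member D) (a : A) :
  exists x : r.-tuple (alpha I A), selected_rep sigma a x.
Proof.
have [f [_ fE]] := quot_map_iso hI A.
have [_ /(_ _ (valP (f a)))] := hsigma A.
move/eqP/cards1P => [x xE]; exists x.
have : x \in sel_set sigma A :&: val (f a) by rewrite xE set11.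
by rewrite /selected_rep inE -fE andbC.
Qed.

Definition selected (L L' : language) (C : class L) (D : class L')
    (r : nat) (I : interp_data C D r)
    (sigma : formula L (block_var 1 r (nparams I)))
    (hI : is_interpretation I) (hsigma : is_selector sigma)
    (A : member D) (a : A) : r.-tuple (alpha I A) :=
  xchoose (selected_rep_exists hI hsigma a).

(* The translation of an L'-formula through I: each variable v becomes the
   r-tuple of variables [inl (v, j)], and the parameters of I are [inr k]. *)
Fixpoint translate (L L' : language) (C : class L) (D : class L') (r : nat)
    (I : interp_data C D r) (V : Type) (f : formula L' V) :
    formula L (V * 'I_r + 'I_(nparams I)) :=
  match f with
  | FBot => FBot
  | FEq x y => rename (fun v => match v with
                               | inl (i, j) => inl (tnth [tuple x; y] i, j)
                               | inr k => inr k
                               end) (eqv_fml I)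
  | FRel R xs => rename (fun v => match v with
                                 | inl (i, j) => inl (tnth xs i, j)
                                 | inr k => inr k
                                 end) (rel_fml I R)
  | FImp g h => FImp (translate I g) (translate I h)
  | FAll g => FAlls (FImp
      (rename (fun v => match v with
                        | inl (_, j) => inr j
                        | inr k => inl (inr k)
                        end) (dom_fml I))
      (rename (fun v => match v with
                        | inl (Some w, j) => inl (inl (w, j))
                        | inl (None, j) => inr j
                        | inr k => inl (inr k)
                        end) (translate I g)))
  end.

(* Position of the j-th entry of the k-th block when n blocks of length r are
   concatenated. *)
Lemma block_ord_subproof (r n : nat) (k : 'I_n) (j : 'I_r) :
  k * r + j < r * n.
Proof.
rewrite [r * n]mulnC; apply: (@leq_trans (k.+1 * r)).
  by rewrite mulSn addnC ltn_add2r.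
by rewrite leq_mul2r ltn_ord orbT.
Qed.

Definition block_ord (r n : nat) (k : 'I_n) (j : 'I_r) : 'I_(r * n) :=
  Ordinal (block_ord_subproof k j).

Lemma concat_subproof (T : Type) (r n : nat) (x : n.-tuple (r.-tuple T)) :
  size (flatten (map val x)) == r * n.
Proof.
rewrite size_flatten.
have /all_pred1P -> : all (pred1 r) (shape (map val x)).
  by rewrite !all_map; elim: (val x) => //= y s ->; rewrite size_tuple eqxx.
by rewrite sumn_nseq !size_map size_tuple.
Qed.

Definition concat (T : Type) (r n : nat) (x : n.-tuple (r.-tuple T)) :
  (r * n).-tuple T := Tuple (concat_subproof x).

(* Consistency of the two encodings of blocks. *)
Lemma tnth_concat (T : Type) (r n : nat) (x : n.-tuple (r.-tuple T))
    (k : 'I_n) (j : 'I_r) :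
  tnth (concat x) (block_ord k j) = tnth (tnth x k) j.
Proof.
case: x => s /= Hs; pose x0 := tnth (tnth (Tuple Hs) k) j.
rewrite (tnth_nth x0) /= (tnth_nth x0 (tnth _ k)).
rewrite (tnth_nth (tnth (Tuple Hs) k)) /=.
move: (x0) (tnth _ k); have: k < size s by rewrite (eqP Hs).
elim: s (val k) {Hs x0} => [|y s IH] [|i] //= lt_is d y0.
  by rewrite nth_cat size_tuple ltn_ord.
rewrite nth_cat size_tuple mulSn -addnA ltnNge leq_addr /= addKn.
exact: IH.
Qed.

(* The translation through I of an L'-formula on m tuples of length q,
   together with the condition that each of the m * q blocks is selected. *)
Definition compose_fml (L L' : language) (C : class L) (D : class L')
    (r : nat) (I : interp_data C D r)
    (sigma : formula L (block_var 1 r (nparams I))) (m q t : nat)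
    (f : formula L' (block_var m q t)) :
    formula L (block_var m (r * q) (r * t + nparams I)) :=
  FAnd
    (rename (fun v => match v with
                      | inl (inl (i, k), j) => inl (i, block_ord k j)
                      | inl (inr l, j) => inr (lshift _ (block_ord l j))
                      | inr z => inr (rshift _ z)
                      end) (translate I f))
    (FConj (fun ik : 'I_m * 'I_q =>
       rename (fun v => match v with
                        | inl (_, j) => inl (ik.1, block_ord ik.2 j)
                        | inr z => inr (rshift _ z)
                        end) sigma)).

Definition compose (L L' L'' : language)
    (C : class L) (D : class L') (E : class L'') (r q : nat)
    (I : interp_data C D r) (sigma : formula L (block_var 1 r (nparams I)))
    (hI : is_interpretation I) (hsigma : is_selector sigma)
    (J : interp_data D E q) : interp_data C E (r * q) :=
  {| alpha := fun B => alpha I (alpha J B);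
     nparams := r * nparams J + nparams I;
     dom_fml := compose_fml sigma (dom_fml J);
     eqv_fml := compose_fml sigma (eqv_fml J);
     rel_fml := fun R => compose_fml sigma (rel_fml J R);
     params := fun B =>
       cat_tuple (concat (map_tuple (selected hI hsigma (A := alpha J B))
                                    (params J B)))
                 (params I (alpha J B));
     quot_map := fun B b =>
       [set concat (map_tuple (selected hI hsigma (A := alpha J B)) a)
          | a in quot_map J b] |}.

(* Main.v *)
(* Replacing every entry of a tuple of elements of A by its selected
   representative is an injection g into tuples of alpha(A).  The selector
   conditions make every set defined by a composite formula the image under g
   of the set defined by the original formula of J, so the conditions on the
   composite interpretation and its selector (the composite of the two
   selectors) transfer along g.  A trace on selected composite representatives
   is reflected first through I, treating the parameters of J as additional
   selected elements of A, and then through J. *)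
Require Import Defs.
From mathcomp Require Import all_boot.

Set Implicit Arguments.
Unset Strict Implicit.
Unset Printing Implicit Defensive.

(** * Semantics of renaming, conjunctions and quantifier blocks *)

Lemma sat_ext (L : language) (M : fin_structure L) (V : Type)
    (f : formula L V) (e e' : V -> M) :
  e =1 e' -> sat f e = sat f e'.
Proof.
elim: V / f e e' => //= [V x y|V R xs|V f IHf g IHg|V f IHf] e e' ee'.
- by rewrite !ee'.
- by congr (interp _); apply: eq_from_tnth => i; rewrite !tnth_map ee'.
- by rewrite (IHf _ _ ee') (IHg _ _ ee').
- by apply: eq_forallb => a; apply: IHf => -[v|] //=.
Qed.

Lemma sat_rename (L : language) (M : fin_structure L) (V W : Type)
    (h : V -> W) (f : formula L V) (e : W -> M) :
  sat (rename h f) e = sat f (e \o h).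
Proof.
elim: V / f W h e => //= [V R xs|V f IHf g IHg|V f IHf] W h e.
- by congr (interp _); apply: eq_from_tnth => i; rewrite !tnth_map.
- by rewrite IHf IHg.
- by apply: eq_forallb => a; rewrite IHf; apply: sat_ext => -[].
Qed.

Lemma sat_FAnd (L : language) (M : fin_structure L) (V : Type)
    (f g : formula L V) (e : V -> M) :
  sat (FAnd f g) e = sat f e && sat g e.
Proof. by rewrite /=; case: sat; case: sat. Qed.

Lemma sat_FConj (L : language) (M : fin_structure L) (V : Type) (T : finType)
    (F : T -> formula L V) (e : V -> M) :
  sat (FConj F) e = [forall i, sat (F i) e].
Proof.
rewrite /FConj; transitivity (all (fun i => sat (F i) e) (enum T)).
  by elim: (enum T) => //= i s <-; rewrite -sat_FAnd.
by apply/allP/forallP => [h i|h i _]; [apply: h; rewrite mem_enum | apply: h].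
Qed.

Lemma sat_FAlls (L : language) (M : fin_structure L) (n : nat) (V : Type)
    (f : formula L (V + 'I_n)) (e : V -> M) :
  sat (FAlls f) e =
  [forall x : n.-tuple M, sat f (fun v => match v with
                                          | inl w => e w
                                          | inr i => tnth x i
                                          end)].
Proof.
elim: n V f e => [|n IHn] V f e /=.
  rewrite sat_rename; apply/idP/forallP => [h x|/(_ [tuple])].
    by apply: etrans h; apply: sat_ext => -[w|[]].
  by congr is_true; apply: sat_ext => -[w|[]].
rewrite IHn; apply/forallP/forallP => [h x|h x /=].
  (* The innermost quantifier of [FAlls] binds index 0 and the outer ones bind the remaining
     indices, so [x] splits into its head and its tail. *)
  have /= /forallP/(_ (thead x)) := h (behead_tuple x).
  rewrite sat_rename; congr is_true; apply: sat_ext => -[w|i] //=.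
  case: (unliftP ord0 i) => [j ->|->] //=; rewrite tnth_behead.
  by congr tnth; apply: val_inj; rewrite /= inordK // ltnS.
apply/forallP => a; rewrite sat_rename; have := h (cons_tuple a x).
congr is_true; apply: sat_ext => -[w|i] //=.
by case: (unliftP ord0 i) => [j ->|->] //=; rewrite tnthS.
Qed.

(** Blocks are indexed by an arbitrary type [V], so that one environment serves both [holds], where
    [V] is an ordinal, and the formulas produced by [translate], whose variables grow under
    quantifiers. *)
Definition block_env (T V : Type) (r s : nat) (x : V -> r.-tuple T)
    (c : s.-tuple T) (v : V * 'I_r + 'I_s) : T :=
  match v with
  | inl (i, j) => tnth (x i) j
  | inr k => tnth c k
  end.

Lemma holdsE (L : language) (M : fin_structure L) (m r s : nat)
    (f : formula L (block_var m r s)) (x : m.-tuple (r.-tuple M))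
    (c : s.-tuple M) :
  holds f x c = sat f (block_env (tnth x) c).
Proof. by []. Qed.

(** * Representatives and the translation of formulas through one interpretation *)

Section Interpretation.

Variables (L L' : language) (C : class L) (D : class L') (r : nat).
Variables (I : interp_data C D r) (hI : is_interpretation I).
Implicit Type A : member D.

Lemma quot_map_class A (a : A) : quot_map I a \in equiv_classes I A.
Proof. by have [f [_ fE]] := quot_map_iso hI A; rewrite -fE (valP (f a)). Qed.

Lemma mem_equiv_class A K x : K \in equiv_classes I A -> x \in K ->
  x \in dom_set I A /\ K = [set y in dom_set I A | eqv_rel x y].
Proof.
case/imsetP => y yD ->; rewrite inE => /andP[xD xy]; split=> //.
apply/setP => z; rewrite !inE; case zD: (holds _ _ _) => //=.
have zD' : z \in dom_set I A by rewrite inE.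
by have [_ /(_ xy) ->] := eqv_equivalence hI yD xD zD'.
Qed.

Lemma quot_map_sub A (a : A) x : x \in quot_map I a -> x \in dom_set I A.
Proof. by case/(mem_equiv_class (quot_map_class a)). Qed.

Lemma quot_map_inj A : injective (@quot_map _ _ _ _ _ I A).
Proof.
have [f [[/bij_inj f_inj _] fE]] := quot_map_iso hI A.
by move=> a b; rewrite -!fE => /val_inj/f_inj.
Qed.

Lemma quot_map_onto A K : K \in equiv_classes I A ->
  exists a : A, K = quot_map I a.
Proof.
have [f [[[g fK gK] _] fE]] := quot_map_iso hI A => KP.
by exists (g (Sub K KP)); rewrite -fE gK.
Qed.

Lemma eqv_rel_refl A x : x \in dom_set I A -> eqv_rel (I := I) x x.
Proof. by move=> xD; case: (eqv_equivalence hI xD xD xD). Qed.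

Lemma dom_set_quot_map A x : x \in dom_set I A ->
  exists a : A, x \in quot_map I a.
Proof.
move=> xD.
have [] := @quot_map_onto A [set y in dom_set I A | eqv_rel x y].
  by apply/imsetP; exists x.
by move=> a Ea; exists a; rewrite -Ea inE xD eqv_rel_refl.
Qed.

Lemma quot_map_neq0 A (a : A) : exists x, x \in quot_map I a.
Proof.
have /imsetP[x xD ->] := quot_map_class a.
by exists x; rewrite inE xD eqv_rel_refl.
Qed.

Lemma quot_map_eqv A (a b : A) x y :
  x \in quot_map I a -> y \in quot_map I b -> eqv_rel x y = (a == b).
Proof.
move=> xa yb; have [xD Ea] := mem_equiv_class (quot_map_class a) xa.
have [yD Eb] := mem_equiv_class (quot_map_class b) yb.
apply/idP/eqP => [xy|ab]; last by move: yb; rewrite -ab Ea inE => /andP[].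
have ya : y \in quot_map I a by rewrite Ea inE yD.
apply: quot_map_inj.
by rewrite Eb; have [_ ->] := mem_equiv_class (quot_map_class a) ya.
Qed.

(** A relation holds in the quotient as soon as some representatives satisfy its formula; invariance
    passes from those to the given ones. *)
Lemma quot_map_rel A (R : L') (a : (arity R).-tuple A) x :
  (forall i, tnth x i \in quot_map I (tnth a i)) ->
  holds (rel_fml I R) x (params I A) = interp a.
Proof.
move=> xa; have [f [[_ f_iso] fE]] := quot_map_iso hI A.
rewrite -f_iso /=; apply/idP/existsP => [xR|[y /andP[/forallP ya yR]]].
  by exists x; rewrite xR andbT; apply/forallP => i; rewrite tnth_map fE.
move: yR; congr is_true; apply: (rel_invariant hI) => i.
have yai : tnth y i \in quot_map I (tnth a i).
  by rewrite -fE; have := ya i; rewrite tnth_map.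
split; rewrite ?(quot_map_sub (xa i)) ?(quot_map_sub yai) //.
by rewrite (quot_map_eqv yai (xa i)).
Qed.

(** The fundamental property of interpretations. Atoms are the two preceding lemmas. Arbitrary
    representatives are allowed, because the translated quantifier ranges over the whole domain and
    not only over selected tuples. *)
Lemma sat_translate A (V : Type) (f : formula L' V) (e : V -> A)
    (x : V -> r.-tuple (alpha I A)) :
  (forall v, x v \in quot_map I (e v)) ->
  sat (translate I f) (block_env x (params I A)) = sat f e.
Proof.
elim: V / f e x => //= [V v w|V R vs|V f IHf g IHg|V f IHf] e x xe.
- rewrite sat_rename -(quot_map_eqv (xe v) (xe w)) /eqv_rel holdsE.
  by apply: sat_ext => -[[[[|[|]] lt_i] j]|k] //=.
- rewrite sat_rename.
  rewrite -(quot_map_rel (x := map_tuple x vs)) => [|i]; last first.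
    by rewrite !tnth_map.
  by rewrite holdsE; apply: sat_ext => -[[i j]|k] //=; rewrite tnth_map.
- by rewrite (IHf _ _ xe) (IHg _ _ xe).
rewrite sat_FAlls.
have step (y : r.-tuple (alpha I A)) (a : A) : y \in quot_map I a ->
    sat f (oapp e a) = sat (translate I f) (block_env (oapp x y) (params I A)).
  by move=> ya; rewrite (IHf (oapp e a)) => // -[].
have domE (y : r.-tuple (alpha I A)) : y \in dom_set I A =
    sat (dom_fml I) (block_env (fun=> y) (params I A)).
  rewrite inE holdsE; apply: sat_ext => -[[i j]|k] //=.
  by rewrite (ord1 i).
have bodyE y : sat (FImp
      (rename (fun v => match v with
                        | inl (_, j) => inr j
                        | inr k => inl (inr k)
                        end) (dom_fml I))
      (rename (fun v => match v with
                        | inl (Some w, j) => inl (inl (w, j))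
                        | inl (None, j) => inr j
                        | inr k => inl (inr k)
                        end) (translate I f)))
      (fun v => match v with
                | inl w => block_env x (params I A) w
                | inr i => tnth y i
                end) =
    (y \in dom_set I A) ==>
    sat (translate I f) (block_env (oapp x y) (params I A)).
  rewrite /= !sat_rename domE; congr (_ ==> _); apply: sat_ext.
    by case=> [[i j]|k].
  by case=> [[[w|] j]|k].
(* The two ranges of quantification match: every element has a representative, and every tuple of
   the domain represents an element. *)
apply/forallP/forallP => [h a|h y].
  have [y ya] := quot_map_neq0 a; have := h y.
  by rewrite bodyE (quot_map_sub ya) (step _ _ ya).
rewrite bodyE; apply/implyP => /dom_set_quot_map[a ya].
by rewrite -(step _ _ ya).
Qed.

End Interpretation.

(** * Block indices, and partitions under a map *)

Lemma unblock_subproof (r n : nat) (i : 'I_(r * n)) : (i %/ r < n) * (i %% r < r).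
Proof.
(* If [r] were 0, the type of [i] would be empty. *)
have r_gt0 : 0 < r by case: r i => // -[].
by rewrite ltn_divLR // [n * r]mulnC ltn_ord ltn_mod.
Qed.

Definition unblock (r n : nat) (i : 'I_(r * n)) : 'I_n * 'I_r :=
  (Ordinal (unblock_subproof i).1, Ordinal (unblock_subproof i).2).

Lemma unblockK (r n : nat) (i : 'I_(r * n)) :
  block_ord (unblock i).1 (unblock i).2 = i.
Proof. by apply: val_inj; rewrite /= -divn_eq. Qed.

Lemma block_tuple_ext (T : Type) (r n : nat) (x y : (r * n).-tuple T) :
  (forall k j, tnth x (block_ord k j) = tnth y (block_ord k j)) -> x = y.
Proof. by move=> xy; apply: eq_from_tnth => i; rewrite -(unblockK i). Qed.

Lemma equivalence_partition_imset (T U : finType) (g : T -> U) (D : {set T})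
    (R : rel T) (S : rel U) :
  injective g -> {in D &, forall x y, S (g x) (g y) = R x y} ->
  equivalence_partition S (g @: D) =
  [set g @: K | K : {set T} in equivalence_partition R D].
Proof.
move=> g_inj SR; rewrite /equivalence_partition -!imset_comp.
apply: eq_in_imset => x xD /=; apply/setP => z; rewrite inE.
apply/andP/imsetP => [[/imsetP[y yD ->] xy]|[y]].
  by exists y => //; rewrite inE yD -SR.
rewrite inE => /andP[yD xy] ->; split; first exact: imset_f.
by rewrite SR.
Qed.

(** * Selected representatives and the formulas built by [compose_fml] *)

Section Selected.

Variables (L L' : language) (C : class L) (D : class L') (r : nat).
Variables (I : interp_data C D r) (hI : is_interpretation I).
Variables (sigma : formula L (block_var 1 r (nparams I))).
Variables (hsigma : is_selector sigma).
Implicit Type A : member D.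

Lemma selected_quot_map A (a : A) : selected hI hsigma a \in quot_map I a.
Proof. by case/andP: (xchooseP (selected_rep_exists hI hsigma a)). Qed.

Lemma selected_sel_set A (a : A) : selected hI hsigma a \in sel_set sigma A.
Proof. by case/andP: (xchooseP (selected_rep_exists hI hsigma a)). Qed.

(** A tuple satisfying [sigma] lies in the domain, hence represents some [a]. It and the chosen
    representative of [a] both lie in the singleton that the selector cuts out of the class of
    [a]. *)
Lemma sel_setP A x :
  reflect (exists a : A, x = selected hI hsigma a) (x \in sel_set sigma A).
Proof.
apply: (iffP idP) => [xS|[a ->]]; last exact: selected_sel_set.
have [sub one] := hsigma A.
have [a xa] := dom_set_quot_map hI (subsetP sub _ xS); exists a.
have /eqP/cards1P[z Ez] := one _ (quot_map_class hI a).
have /set1P-> : x \in [set z] by rewrite -Ez inE xS.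
apply/esym/set1P; rewrite -Ez inE.
by rewrite selected_sel_set selected_quot_map.
Qed.

Lemma selected_inj A : injective (selected hI hsigma (A := A)).
Proof.
move=> a b ab; apply/eqP.
rewrite -(quot_map_eqv hI (selected_quot_map a) (selected_quot_map b)) ab.
by rewrite (quot_map_eqv hI (selected_quot_map b) (selected_quot_map b)).
Qed.

(** [compose] builds both its [quot_map] and the first part of its parameters with this map, so
    later statements about [compose] match it by conversion. *)
Definition selected_concat A n (y : n.-tuple A) : (r * n).-tuple (alpha I A) :=
  concat (map_tuple (selected hI hsigma (A := A)) y).

Lemma tnth_selected_concat A n (y : n.-tuple A) k j :
  tnth (selected_concat y) (block_ord k j) =
  tnth (selected hI hsigma (tnth y k)) j.
Proof. by rewrite tnth_concat tnth_map. Qed.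

Lemma selected_concat_inj A n : injective (@selected_concat A n).
Proof.
move=> y z yz; apply: eq_from_tnth => k; apply: selected_inj.
by apply: eq_from_tnth => j; rewrite -!tnth_selected_concat yz.
Qed.

Lemma sel_setE A x :
  (x \in sel_set sigma A) = sat sigma (block_env (fun=> x) (params I A)).
Proof.
by rewrite inE holdsE; apply: sat_ext => -[[i j]|k] //=; rewrite (ord1 i).
Qed.

(** On selected tuples the selector conjuncts are automatically true, and what remains is an
    instance of [sat_translate]. *)
Lemma holds_compose A (m q t : nat) (f : formula L' (block_var m q t))
    (y : m.-tuple (q.-tuple A)) (c : t.-tuple A) :
  holds (compose_fml sigma f) (map_tuple (@selected_concat A q) y)
    (cat_tuple (selected_concat c) (params I A)) = holds f y c.
Proof.
rewrite !holdsE sat_FAnd sat_FConj sat_rename.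
(* The parameters [c] are translated as variables like the entries of [y], and are represented in
   the same way. *)
set e := block_env (tnth y) c.
rewrite -(sat_translate hI f (x := fun v => selected hI hsigma (e v))); last first.
  by move=> v; apply: selected_quot_map.
rewrite [X in _ && X](_ : _ = true); last first.
  apply/forallP => -[i k]; rewrite sat_rename.
  have := selected_sel_set (tnth (tnth y i) k); rewrite sel_setE.
  congr is_true; apply: sat_ext => -[[i0 j]|z] /=.
    by rewrite tnth_map tnth_selected_concat.
  by rewrite tnth_rshift.
rewrite andbT; apply: sat_ext => -[[[[i k]|l] j]|z] /=.
- by rewrite tnth_map tnth_selected_concat.
- by rewrite tnth_lshift tnth_selected_concat.
- by rewrite tnth_rshift.
Qed.

(** The selector conjuncts force every block of length [r] to be a selected representative, so only
    tuples in the image can satisfy a composite formula. *)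
Lemma holds_compose_selected A (m q t : nat) (f : formula L' (block_var m q t))
    (x : m.-tuple ((r * q).-tuple (alpha I A))) (c : t.-tuple A) :
  holds (compose_fml sigma f) x
    (cat_tuple (selected_concat c) (params I A)) ->
  exists y : m.-tuple (q.-tuple A), x = map_tuple (@selected_concat A q) y.
Proof.
rewrite holdsE sat_FAnd sat_FConj => /andP[_ /forallP sel].
have sel_block ik : exists a : A,
    [tuple tnth (tnth x ik.1) (block_ord ik.2 j) | j < r] =
    selected hI hsigma a.
  apply/sel_setP; rewrite sel_setE; have := sel ik; rewrite sat_rename.
  congr is_true; apply: sat_ext => -[[i0 j]|z] /=.
    by rewrite tnth_mktuple.
  by rewrite tnth_rshift.
have [y yE] := fin_all_exists sel_block.
exists [tuple [tuple y (i, k) | k < q] | i < m].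
apply: eq_from_tnth => i; rewrite tnth_map tnth_mktuple.
apply: block_tuple_ext => k j; rewrite tnth_selected_concat tnth_mktuple -yE.
by rewrite tnth_mktuple.
Qed.

(** Applied below to the domain formula and to the selector of [J]. *)
Lemma holds_compose_imset A (q t : nat) (f : formula L' (block_var 1 q t))
    (c : t.-tuple A) :
  [set x | holds (compose_fml sigma f) [tuple x]
             (cat_tuple (selected_concat c) (params I A))] =
  (@selected_concat A q) @: [set y | holds f [tuple y] c].
Proof.
have tuple1 y : [tuple selected_concat y] =
    map_tuple (@selected_concat A q) [tuple y] by apply: val_inj.
apply/setP => x; rewrite inE; apply/idP/imsetP => [xf|[y]].
  have [y /(congr1 (fun z => tnth z ord0))] := holds_compose_selected xf.
  rewrite tnth_map => xE; exists (tnth y ord0); last exact: xE.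
  by rewrite inE -(holds_compose f) -tuple1 -xE.
by rewrite inE => yf ->; rewrite tuple1 holds_compose.
Qed.

End Selected.

(** * The composite is an interpretation *)

Section Compose.

Variables (L L' L'' : language) (C : class L) (D : class L') (E : class L'').
Variables (r q : nat) (I : interp_data C D r) (J : interp_data D E q).
Variables (hI : is_interpretation I) (hJ : is_interpretation J).
Variables (sigma : formula L (block_var 1 r (nparams I))).
Variables (hsigma : is_selector sigma).
Implicit Type B : member E.

Let IJ := compose hI hsigma J.
Let g B := @selected_concat _ _ _ _ _ _ hI _ hsigma (alpha J B) q.

Lemma dom_set_compose B : dom_set IJ B = @g B @: dom_set J B.
Proof. exact: holds_compose_imset. Qed.

Lemma eqv_rel_compose B x y :
  eqv_rel (I := IJ) (A := B) (g x) (g y) = eqv_rel (I := J) x y.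
Proof.
rewrite /eqv_rel -(holds_compose hI hsigma); congr holds.
exact: val_inj.
Qed.

Lemma equiv_classes_compose B :
  equiv_classes IJ B =
  [set @g B @: K | K : {set q.-tuple (alpha J B)} in equiv_classes J B].
Proof.
rewrite /equiv_classes dom_set_compose.
apply: equivalence_partition_imset; first exact: selected_concat_inj.
by move=> x y _ _; apply: eqv_rel_compose.
Qed.

Lemma holds_rel_compose B (R : L'') y :
  holds (rel_fml IJ R) (map_tuple (@g B) y) (params IJ B) =
  holds (rel_fml J R) y (params J B).
Proof. exact: holds_compose. Qed.

Lemma compose_quot_map_iso B : exists f : B -> quotient IJ B,
  isomorphism f /\ forall b : B, val (f b) = quot_map IJ b.
Proof.
have class_b (b : B) : quot_map IJ b \in equiv_classes IJ B.
  by rewrite equiv_classes_compose; apply/imset_f/quot_map_class.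
exists (fun b => Sub (quot_map IJ b) (class_b b)).
split=> //; split=> [|R b].
  apply: inj_card_bij => [a b /(congr1 val)/= ab|].
    apply: (quot_map_inj hJ); apply: imset_inj ab.
    exact: selected_concat_inj.
  (* Counting replaces an explicit inverse: the composite classes are images under [g] of classes of
     [J], and each of these is [quot_map J b] for some [b]. *)
  rewrite card_sig /= -[#|B|](card_imset _ (quot_map_inj hJ (A := B))).
  rewrite (eq_card (B := equiv_classes IJ B)) // equiv_classes_compose.
  apply: leq_trans (leq_imset_card _ _) _.
  apply/subset_leq_card/subsetP => K /(quot_map_onto hJ)[b ->].
  exact: imset_f.
apply/existsP/idP => [[x /andP[/forallP xb xR]]|bR].
  (* The witness [x] satisfies a composite formula, so it comes from tuples over [alpha J B], where
     [quot_map_rel] for [J] applies. *)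
  have [y xE] : exists y, x = map_tuple (@g B) y.
    exact: holds_compose_selected xR.
  move: xR; rewrite xE holds_rel_compose (quot_map_rel hJ (a := b)) // => i.
  have := xb i; rewrite xE !tnth_map /= mem_imset //.
  exact: selected_concat_inj.
have [y yb] := fin_all_exists (fun i => quot_map_neq0 hJ (tnth b i)).
exists (map_tuple (@g B) (mktuple y)); apply/andP; split.
  by apply/forallP => i; rewrite !tnth_map /= imset_f ?tnth_ord_tuple.
rewrite holds_rel_compose (quot_map_rel hJ (a := b)) // => i.
by rewrite tnth_mktuple.
Qed.

Lemma compose_is_interpretation : is_interpretation IJ.
Proof.
split.
- by rewrite muln_gt0 (arity_gt0 hI) (arity_gt0 hJ).
- by move=> B B' /(alpha_inj hI)/(alpha_inj hJ).
- move=> B x y z; rewrite dom_set_compose.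
  move=> /imsetP[x' x'D ->] /imsetP[y' y'D ->] /imsetP[z' z'D ->].
  by rewrite !eqv_rel_compose; apply: (eqv_equivalence hJ).
- move=> B R x y xy.
  (* Both tuples are pulled back along [g] entry by entry, to reach the invariance known for [J]. *)
  have pre i : exists p : q.-tuple (alpha J B) * q.-tuple (alpha J B),
      [/\ tnth x i = g p.1, tnth y i = g p.2, p.1 \in dom_set J B,
          p.2 \in dom_set J B & eqv_rel p.1 p.2].
    have [] := xy i; rewrite dom_set_compose.
    move=> /imsetP[x' x'D ->] /imsetP[y' y'D ->]; rewrite eqv_rel_compose.
    by exists (x', y').
  have [p pP] := fin_all_exists pre.
  have -> : x = map_tuple (@g B) (mktuple (fun i => (p i).1)).
    by apply: eq_from_tnth => i; rewrite tnth_map tnth_mktuple; case: (pP i).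
  have -> : y = map_tuple (@g B) (mktuple (fun i => (p i).2)).
    by apply: eq_from_tnth => i; rewrite tnth_map tnth_mktuple; case: (pP i).
  rewrite !holds_rel_compose; apply: (rel_invariant hJ) => i.
  by rewrite !tnth_mktuple; case: (pP i).
- exact: compose_quot_map_iso.
Qed.

(** * Selector and trace reflection for the composite *)

Variables (tau : formula L' (block_var 1 q (nparams J))).
Variable htau : is_selector tau.

Definition compose_selector : formula L (block_var 1 (r * q) (nparams IJ)) :=
  compose_fml sigma tau.

Lemma sel_set_compose B :
  sel_set compose_selector B = @g B @: sel_set tau B.
Proof. exact: holds_compose_imset. Qed.

(** Being injective, [g] commutes with intersections and preserves cardinality, so each composite
    class inherits its unique selected element from [tau]. *)
Lemma compose_is_selector : is_selector compose_selector.
Proof.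
move=> B; have [sub one] := htau B; rewrite sel_set_compose; split.
  by rewrite dom_set_compose imsetS.
move=> K; rewrite equiv_classes_compose => /imsetP[K' K'P ->].
have g_inj := @selected_concat_inj _ _ _ _ _ _ hI _ hsigma (alpha J B) q.
by rewrite -imsetI ?card_imset ?one // => x y _ _; apply: g_inj.
Qed.

Lemma selected_rep_compose B (b : B) x :
  selected_rep compose_selector b x ->
  exists2 y, x = g y & selected_rep tau b y.
Proof.
case/andP; rewrite sel_set_compose => xb /imsetP[y yS xE]; exists y => //.
rewrite /selected_rep yS andbT; move: xb; rewrite xE mem_imset //.
exact: selected_concat_inj.
Qed.

(* Over selected representatives, the parameters of J play the same role as
   the entries of the q-tuples, so both index the blocks to be reflected by I. *)
Definition split_blocks (m t s : nat)
    (rho : formula L (block_var m (r * q) (r * t + s))) :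
    formula L (block_var #|{: 'I_m * 'I_q + 'I_t}| r s) :=
  rename (fun v => match v with
    | inl (i, p) => inl (enum_rank (inl (i, (unblock p).1)), (unblock p).2)
    | inr k => match split k with
               | inl l => inl (enum_rank (inr (unblock l).1), (unblock l).2)
               | inr z => inr z
               end
    end) rho.

Lemma compose_trace_reflecting :
  trace_reflecting sigma -> trace_reflecting tau ->
  trace_reflecting compose_selector.
Proof.
(* Each block of [rho] becomes one variable of [rho1], ranging over the intermediate structure. *)
move=> rI rJ m rho; have [rho1 rho1P] := rI _ (split_blocks rho).
(* Renaming by [enum_val] turns the numbered variables back into entries of [q]-tuples and
   parameters of [J], the shape that [rJ] accepts. *)
have [rho2 rho2P] := rJ m (rename enum_val rho1).
exists rho2 => B b x xb.
have [y yb] := fin_all_exists2 (fun i => selected_rep_compose (xb i)).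
move=> {xb} yS; rewrite (rho2P B b (mktuple y)) => [|i]; last first.
  by rewrite tnth_mktuple.
rewrite holdsE sat_rename; set e := block_env _ _.
pose n := #|{: 'I_m * 'I_q + 'I_(nparams J)}|.
(* [a] lists the entries of all the [y i] and the parameters of [J] in enumeration order; their
   selected representatives are the blocks of [x] and of the composite parameters. *)
have [a aE] : exists a : n.-tuple (alpha J B), tnth a =1 e \o enum_val.
  by exists (mktuple (e \o enum_val)) => i; rewrite tnth_mktuple.
rewrite -(sat_ext _ aE).
rewrite (rho1P _ a (map_tuple (selected hI hsigma (A := _)) a)) => [|i].
  rewrite !holdsE sat_rename; apply: sat_ext => -[[i p]|k] /=.
    rewrite tnth_map aE /= enum_rankK /= tnth_mktuple yb.
    by rewrite -tnth_selected_concat unblockK.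
  (* A composite parameter is either a coordinate of the block selected for a parameter of [J], or a
     parameter of [I] itself. *)
  rewrite -{2}(splitK k); case: (split k) => [l|z] /=.
    rewrite tnth_map aE /= enum_rankK /= tnth_lshift.
    by rewrite -tnth_selected_concat unblockK.
  by rewrite tnth_rshift.
by rewrite tnth_map /selected_rep selected_quot_map selected_sel_set.
Qed.

End Compose.

Theorem theorem7p7 (L L' L'' : language)
    (C : class L) (D : class L') (E : class L'') (r q : nat)
    (I : interp_data C D r) (J : interp_data D E q)
    (hI : is_interpretation I) (hJ : is_interpretation J)
    (sigma : formula L (block_var 1 r (nparams I)))
    (tau : formula L' (block_var 1 q (nparams J)))
    (hsigma : is_selector sigma) (htau : is_selector tau)
    (rI : trace_reflecting sigma) (rJ : trace_reflecting tau) :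
  is_interpretation (compose hI hsigma J) /\
  exists ups : formula L
      (block_var 1 (r * q) (nparams (compose hI hsigma J))),
    is_selector ups /\ trace_reflecting ups.
Proof.
split; first exact: compose_is_interpretation.
exists (compose_selector hI hsigma tau); split.
  exact: compose_is_selector.
exact: compose_trace_reflecting.
Qed.
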